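(* Let $\lambda=(\lambda_1,\dots,\lambda_m)$ be a partition of $n$ whose parts are distinct with the possible exception of the largest part, i.e. every part of $\lambda$ smaller than $\lambda_1$ occurs exactly once. Then $b_\lambda(-1)$ equals the number of standard shifted tableaux of shape $\lambda$.
   Context: For a standard tableau $T=(T_{ij})$ of shape $\lambda$ (a filling of the Young diagram of $\lambda$ with $1,\dots,|\lambda|$, rows and columns increasing), and $2\le j\le\lambda_i$, let $c_{ij}(T)=\#\{i'\ge i:\text{cell }(i',j-1)\text{ exists and }T_{i',j-1}<T_{ij}\}$, $c_q(T)=\prod_i\prod_{j=2}^{\lambda_i}[c_{ij}(T)]_q$ with $[a]_q=1+q+\dots+q^{a-1}$, and $b_\lambda(q)=\sum_T c_q(T)$ over all standard tableaux $T$ of shape $\lambda$. A shifted tableau of shape $\lambda$ is an array $(T_{ij})$ with $1\le i\le m$ and $i\le j\le\lambda_i+i-1$ (row $i$ shifted $i-1$ cells to the right). It is a standard shifted tableau if its entries are exactly $1,\dots,n$, each once, and rows increase left to right, columns increase top to bottom, and diagonals increase from top-left to bottom-right. *)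

(* Defs.v *)
From HB Require Import structures.
From mathcomp Require Import all_boot all_order all_algebra.

Set Implicit Arguments.
Unset Strict Implicit.
Unset Printing Implicit Defensive.

Import GRing.Theory.

Definition is_partition_of (n : nat) (la : seq nat) : Prop :=
  [/\ sorted geq la, 0 \notin la & sumn la = n].

Definition distinct_below_largest (la : seq nat) : Prop :=
  forall p, p \in la -> p < head 0 la -> count_mem p la = 1.

(* Cells are pairs (row, column), both numbered from 1; the part la_i is      *)
(* nth 0 la i.-1.                                                             *)
Definition young_diagram (la : seq nat) : seq (nat * nat) :=
  [seq (i, j) | i <- iota 1 (size la), j <- iota 1 (nth 0 la i.-1)].

(* Row i occupies the columns i, ..., la_i + i - 1.                           *)
Definition shifted_diagram (la : seq nat) : seq (nat * nat) :=
  [seq (i, j) | i <- iota 1 (size la), j <- iota i (nth 0 la i.-1)].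

Section Fillings.

Variables (D : seq (nat * nat)) (n : nat).

Definition cell : finType := seq_sub D.
Definition crow (x : cell) : nat := (val x).1.
Definition ccol (x : cell) : nat := (val x).2.

Definition filling : finType := {ffun cell -> 'I_n.+1}.

Implicit Type T : filling.

Definition standard_entries T : bool :=
  perm_eq [seq val (T x) | x : cell] (iota 1 n).

Definition rows_increase T : bool :=
  [forall x, forall y,
    (crow x == crow y) && (ccol x < ccol y) ==> (T x < T y)].

Definition columns_increase T : bool :=
  [forall x, forall y,
    (ccol x == ccol y) && (crow x < crow y) ==> (T x < T y)].

(* x and y are on a common diagonal iff column - row agrees; written          *)
(* additively because subtraction on nat truncates.                           *)
Definition diagonals_increase T : bool :=
  [forall x, forall y,
    (ccol x + crow y == ccol y + crow x) && (crow x < crow y)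
      ==> (T x < T y)].

End Fillings.

Definition standard_tableaux (la : seq nat) :
    {set filling (young_diagram la) (sumn la)} :=
  [set T | [&& standard_entries T, rows_increase T & columns_increase T]].

Definition standard_shifted_tableaux (la : seq nat) :
    {set filling (shifted_diagram la) (sumn la)} :=
  [set T | [&& standard_entries T, rows_increase T, columns_increase T
             & diagonals_increase T]].

Definition c_stat (D : seq (nat * nat)) (n : nat) (T : filling D n)
    (x : cell D) : nat :=
  #|[set y : cell D | [&& crow x <= crow y, (ccol y).+1 == ccol x
                        & T y < T x]]|.

Local Open Scope ring_scope.

(* The indeterminate q is 'X in {poly int}.                                   *)
Definition qint (a : nat) : {poly int} := \sum_(k < a) 'X^k.

Definition c_q (D : seq (nat * nat)) (n : nat) (T : filling D n) :
    {poly int} :=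
  \prod_(x : cell D | (2 <= ccol x)%N) qint (c_stat T x).

Definition b_poly (la : seq nat) : {poly int} :=
  \sum_(T in standard_tableaux la) c_q T.

(* Main.v *)
Require Import Defs.
From HB Require Import structures.
From mathcomp Require Import all_boot all_order all_algebra.
From mathcomp Require Import zify.

Set Implicit Arguments.
Unset Strict Implicit.
Unset Printing Implicit Defensive.

Import GRing.Theory.

(** Since [a]_{-1} is 1 for odd a and 0 for even a, b_la(-1) counts the
    standard tableaux T all of whose c_ij(T) are odd. Shifting rows, standard
    shifted tableaux become the standard tableaux with T_ij < T_(i+1,j-1)
    whenever both cells exist; for these every c_ij(T) is 1. Conversely, let
    all c_ij(T) be odd and suppose T_(i+1,j-1) < T_ij. Then c_ij(T) >= 2, hence
    c_ij(T) >= 3 and T_(i+2,j-1) < T_ij. As parts below the largest one are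
    distinct, cell (i+1,j) exists, and T_(i+2,j-1) < T_ij < T_(i+1,j): the
    violation propagates down the columns forever, which is absurd. *)

(** * Cells as coordinate pairs *)

Section Cells.

Variable D : seq (nat * nat).
Implicit Types x y : cell D.

Lemma cell_eq x y : crow x = crow y -> ccol x = ccol y -> x = y.
Proof. by move=> E F; apply: val_inj; apply: injective_projections. Qed.

Lemma cell_mem x : (crow x, ccol x) \in D.
Proof. by have := valP x; rewrite /crow /ccol; case: (val x). Qed.

End Cells.

(** * Diagrams of a partition whose parts below the largest are distinct *)

Section Shape.

Variable la : seq nat.
Hypothesis la_sorted : sorted geq la.

Lemma mem_young i j : ((i, j) \in young_diagram la) =
  [&& 0 < i, i <= size la, 0 < j & j <= nth 0 la i.-1].
Proof.
apply/allpairsPdep/idP => [[a [b [Ha Hb [-> ->]]]]|/and4P[Hi Hi' Hj Hj']].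
  by move: Ha Hb; rewrite !mem_iota; lia.
by exists i, j; split; rewrite ?mem_iota //; lia.
Qed.

Lemma mem_shifted i j : ((i, j) \in shifted_diagram la) =
  [&& 0 < i, i <= size la, i <= j & j < i + nth 0 la i.-1].
Proof.
apply/allpairsPdep/idP => [[a [b [Ha Hb [-> ->]]]]|/and4P[Hi Hi' Hj Hj']].
  by move: Ha Hb; rewrite !mem_iota; lia.
by exists i, j; split; rewrite ?mem_iota //; lia.
Qed.

Lemma nth_partition_le a b : a <= b -> nth 0 la b <= nth 0 la a.
Proof.
move=> Hab; have [Hb|Hb] := ltnP b (size la); last by rewrite (nth_default _ Hb).
have geq_trans : transitive geq by move=> y x z /= Hxy Hyz; apply: leq_trans Hyz Hxy.
apply: (sorted_leq_nth geq_trans) => //; first exact: leqnn.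
by rewrite inE; lia.
Qed.

Lemma mem_young_le i j a b : (i, j) \in young_diagram la ->
  0 < a <= i -> 0 < b <= j -> (a, b) \in young_diagram la.
Proof.
rewrite !mem_young => /and4P[_ Hi _ Hj] /andP[-> Ha] /andP[-> Hb].
rewrite (leq_trans Ha Hi) /= (leq_trans Hb) // (leq_trans Hj) //.
by apply: nth_partition_le; lia.
Qed.

Hypothesis la_distinct : distinct_below_largest la.

(** Otherwise monotonicity forces both parts to equal [k], and a value below the largest part occurs
    twice. *)
Lemma nth_partition_lt a k : a.+1 < size la -> k < head 0 la ->
  k <= nth 0 la a.+1 -> k < nth 0 la a.
Proof.
move=> Ha Hk Hk1; rewrite ltnNge; apply/negP => Hk2.
have Hm := nth_partition_le (leqnSn a).
have E1 : nth 0 la a = k by lia.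
have E2 : nth 0 la a.+1 = k by lia.
have := la_distinct (p := k); rewrite -{1}E2 mem_nth // => /(_ isT Hk).
(* Cutting [la] at index [a] exposes both occurrences of [k] to the count. *)
rewrite -(cat_take_drop a la) count_cat (drop_nth 0) ?(drop_nth 0 Ha) /=; last by lia.
by rewrite E1 E2 !eqxx; lia.
Qed.

(* The cell (i', j') only serves to certify that j < la_1. *)
Lemma mem_young_antidiag i j i' j' : (i.+1, j) \in young_diagram la -> 0 < i ->
  (i', j') \in young_diagram la -> j < j' -> (i, j.+1) \in young_diagram la.
Proof.
rewrite !mem_young => /and4P[_ Hi Hj Hj'] Hi0 /and4P[Ki Ki' Kj Kj'] Hjj.
rewrite Hi0 (ltnW Hi) /=.
case: i Hi0 Hi Hj' => // a _ /= Ha Hj'; apply: nth_partition_lt => //.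
rewrite -nth0; apply: leq_trans Hjj _; apply: leq_trans Kj' _.
exact: nth_partition_le.
Qed.

(** * Odd statistics and increase along antidiagonals *)

Section Tableau.

Variables (n : nat) (T : filling (young_diagram la) n).
Hypotheses (T_rows : rows_increase T) (T_cols : columns_increase T).

Notation Y := (cell (young_diagram la)).

(** Row shifting turns antidiagonals into columns; all pairs are compared, not only neighbours, to
    match [columns_increase]. *)
Definition antidiagonals_increase : bool :=
  [forall x : Y, forall y : Y,
    (crow x + ccol x == crow y + ccol y) && (crow x < crow y) ==> (T x < T y)].

Lemma row_lt (x y : Y) : crow x = crow y -> ccol x < ccol y -> T x < T y.
Proof.
by move=> E H; move/forallP: T_rows => /(_ x)/forallP/(_ y); rewrite E eqxx H.
Qed.

Lemma col_lt (x y : Y) : ccol x = ccol y -> crow x < crow y -> T x < T y.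
Proof.
by move=> E H; move/forallP: T_cols => /(_ x)/forallP/(_ y); rewrite E eqxx H.
Qed.

Lemma cellP i j : (i, j) \in young_diagram la ->
  exists x : Y, crow x = i /\ ccol x = j.
Proof. by move=> H; exists (SeqSub H). Qed.

Lemma cell_gt0 (x : Y) : (0 < crow x) && (0 < ccol x).
Proof. by have := cell_mem x; rewrite mem_young => /and4P[-> _ ->]. Qed.

Lemma c_stat_gt0 (x : Y) : 1 < ccol x -> 0 < c_stat T x.
Proof.
move=> Hx; have /andP[Hx0 _] := cell_gt0 x.
have [|y [Ey Fy]] := @cellP (crow x) (ccol x).-1.
  by apply: mem_young_le (cell_mem x) _ _; lia.
apply/card_gt0P; exists y; rewrite inE Ey leqnn Fy prednK ?eqxx //=; last by lia.
by apply: row_lt => //; lia.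
Qed.

(** Only the left neighbour of [x] is counted: if [w] were counted in a lower row, the cell [v] in
    the column of [w], one row below [x], would give [T x < T v <= T w]. *)
Lemma c_stat_eq1 (x : Y) :
  antidiagonals_increase -> 1 < ccol x -> c_stat T x = 1.
Proof.
move=> Hanti Hx; apply/eqP; rewrite eqn_leq c_stat_gt0 // andbT.
apply/card_le1_eqP => y z.
suff H w : w \in [set y : Y | [&& crow x <= crow y, (ccol y).+1 == ccol x
    & T y < T x]] -> crow w = crow x /\ (ccol w).+1 = ccol x.
  by move=> /H[Ey Fy] /H[Ez Fz]; apply: cell_eq; lia.
rewrite inE => /and3P[Hr /eqP Hc Hlt]; split => //; apply/eqP.
rewrite eqn_leq Hr andbT leqNgt; apply/negP => Hxw.
have [|v [Ev Fv]] := @cellP (crow x).+1 (ccol w).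
  by have := cell_gt0 w; move=> ?; apply: mem_young_le (cell_mem w) _ _; lia.
have Hvw : T v <= T w.
  have [Hvw|Hvw] := eqVneq (crow v) (crow w).
    by rewrite (cell_eq Hvw Fv).
  by apply: ltnW; apply: col_lt => //; lia.
have /forallP/(_ x)/forallP/(_ v)/implyP := Hanti.
rewrite Ev Fv -Hc addnS addSn eqxx ltnSn => /(_ isT) Hxv.
by have := leq_ltn_trans Hvw (ltn_trans Hlt Hxv); rewrite ltnn.
Qed.

Hypothesis c_odd : forall x : Y, 1 < ccol x -> odd (c_stat T x).

Lemma antidiag_violation_propagates (x y : Y) :
  crow y = (crow x).+1 -> ccol x = (ccol y).+1 -> T y < T x ->
  exists x' y' : Y, [/\ crow x' = (crow x).+1, crow y' = (crow x').+1,
    ccol x' = (ccol y').+1 & T y' < T x'].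
Proof.
move=> Er Ec Hlt; have /andP[y1 y2] := cell_gt0 y; have /andP[x1 x2] := cell_gt0 x.
(* The left neighbour [w] of [x] and the cell [y] are two counted cells, so oddness yields a third
   one, [z]. *)
have [|w [Ew Fw]] := @cellP (crow x) (ccol y).
  by apply: mem_young_le (cell_mem y) _ _; lia.
have Hwx : T w < T x by apply: row_lt; lia.
set A := [set z : Y | [&& crow x <= crow z, (ccol z).+1 == ccol x & T z < T x]].
have HwA : w \in A by rewrite inE Ew Fw Ec leqnn eqxx.
have HyA : y \in A by rewrite inE Er Ec leqnSn eqxx.
have Hwy : w != y by apply/eqP => E; move: Er; rewrite -E; lia.
have HA : 2 < #|A|.
  have : #|[set w; y]| <= #|A|.
    by apply: subset_leq_card; apply/subsetP => z /set2P[]->.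
  have : odd #|A| by apply: c_odd; rewrite Ec.
  by rewrite cards2 Hwy; case: #|A| => [|[|[|]]].
have [z HzA Hz] : exists2 z, z \in A & z \notin [set w; y].
  by apply/subsetPn; apply/negP => /subset_leq_card; rewrite cards2 Hwy leqNgt HA.
move: HzA Hz; rewrite !inE negb_or => /and3P[Hr /eqP Hc Hzx] /andP[Nw Ny].
(* The first two admissible rows of this column are taken by [w] and [y]. *)
have Hr2 : (crow x).+1 < crow z.
  rewrite ltn_neqAle; apply/andP; split.
    by apply: contraNneq Ny => E; apply/eqP; apply: cell_eq; lia.
  rewrite ltn_neqAle Hr andbT.
  by apply: contraNneq Nw => E; apply/eqP; apply: cell_eq; lia.
have [|y' [Ey' Fy']] := @cellP (crow x).+2 (ccol y).
  by apply: mem_young_le (cell_mem z) _ _; lia.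
have Hy'z : T y' <= T z.
  have [H|H] := eqVneq (crow y') (crow z).
    by have -> : y' = z by apply: cell_eq; lia.
  by apply: ltnW; apply: col_lt; lia.
(* The cell just below [x] exists because [y'] lies in the next row and [x] bounds the column by the
   largest part. *)
have [|x' [Ex' Fx']] := @cellP (crow x).+1 (ccol y).+1.
  apply: mem_young_antidiag (cell_mem x) _ => //; last by lia.
  by rewrite -Ey' -Fy' cell_mem.
exists x', y'; split; try lia.
have : T x < T x' by apply: col_lt; lia.
lia.
Qed.

(** Here [m] bounds the number of rows below [x]: a violation moves down row by row, and at [m = 0]
    no row is left for [y]. *)
Lemma no_antidiag_violation m (x y : Y) : size la <= crow x + m ->
  crow y = (crow x).+1 -> ccol x = (ccol y).+1 -> T x <= T y.
Proof.
elim: m x y => [|m IHm] x y Hm Er Ec; rewrite leqNgt; apply/negP => Hlt.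
  by have := cell_mem y; rewrite mem_young Er; lia.
have [x' [y' [Ex Ey Ez Hlt']]] := antidiag_violation_propagates Er Ec Hlt.
have Hm' : size la <= crow x' + m by lia.
by have := IHm x' y' Hm' Ey Ez; lia.
Qed.

Hypothesis T_inj : injective T.

Lemma antidiag_adjacent_lt (x y : Y) :
  crow y = (crow x).+1 -> ccol x = (ccol y).+1 -> T x < T y.
Proof.
move=> Er Ec; rewrite ltn_neqAle (no_antidiag_violation (leq_addl _ _) Er Ec).
rewrite andbT; apply/eqP => /val_inj/T_inj E.
by move: Er; rewrite E; lia.
Qed.

(** Adjacent comparisons chain along the antidiagonal, by induction on the row distance. *)
Lemma c_odd_antidiagonals_increase : antidiagonals_increase.
Proof.
apply/forallP => x; apply/forallP => y; apply/implyP => /andP[/eqP E H].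
have [d Hd] : exists d, crow y = crow x + d.+1.
  by exists (crow y - crow x).-1; lia.
elim: d y E H Hd => [|d IHd] y E H Hd.
  by apply: antidiag_adjacent_lt; lia.
have /andP[y1 y2] := cell_gt0 y; have /andP[x1 x2] := cell_gt0 x.
(* The antidiagonal has no gap above [y]: [x] lies in a column further right, so the column of [z]
   is within the largest part. *)
have [|z [Ez Fz]] := @cellP (crow y).-1 (ccol y).+1.
  apply: mem_young_antidiag (cell_mem x) _; try lia.
  by rewrite prednK // cell_mem.
have Hzy : T z < T y by apply: antidiag_adjacent_lt; lia.
have : T x < T z by apply: IHd; lia.
lia.
Qed.

End Tableau.

(** * Row shifting as a bijection of fillings *)

Section Shift.

Notation Y := (cell (young_diagram la)).
Notation S := (cell (shifted_diagram la)).

Lemma shift_subproof (x : Y) :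
  (crow x, ccol x + (crow x).-1) \in shifted_diagram la.
Proof.
by have := cell_mem x; rewrite mem_young mem_shifted => /and4P[? ? ? ?]; lia.
Qed.

Lemma unshift_subproof (y : S) :
  (crow y, ccol y - (crow y).-1) \in young_diagram la.
Proof.
have := cell_mem y.
by rewrite mem_young mem_shifted => /and4P[? ? ? ?]; lia.
Qed.

Definition shift_cell (x : Y) : S := SeqSub (shift_subproof x).
Definition unshift_cell (y : S) : Y := SeqSub (unshift_subproof y).

Lemma crow_shift (x : Y) : crow (shift_cell x) = crow x.
Proof. by []. Qed.

Lemma ccol_shift (x : Y) : ccol (shift_cell x) = ccol x + (crow x).-1.
Proof. by []. Qed.

Lemma shift_cellK : cancel shift_cell unshift_cell.
Proof.
by move=> x; apply: cell_eq; rewrite /crow /ccol //= addnK.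
Qed.

Lemma unshift_cellK : cancel unshift_cell shift_cell.
Proof.
move=> y; apply: cell_eq; rewrite // {1}/ccol /= subnK //.
(* In the shifted diagram the column is at least the row, so the subtraction does not truncate. *)
by have := cell_mem y; rewrite mem_shifted {4}/crow /=; lia.
Qed.

Variable n : nat.

Definition shift_filling (T : filling (young_diagram la) n) :
  filling (shifted_diagram la) n := [ffun y => T (unshift_cell y)].

Lemma shift_filling_bij : bijective shift_filling.
Proof.
exists (fun U : filling (shifted_diagram la) n => [ffun x => U (shift_cell x)]).
  by move=> T; apply/ffunP => x; rewrite !ffunE shift_cellK.
by move=> U; apply/ffunP => y; rewrite !ffunE unshift_cellK.
Qed.

Lemma standard_entries_shift T :
  standard_entries (shift_filling T) = standard_entries T.
Proof.
rewrite /standard_entries; have -> : [seq val (shift_filling T y) | y : S] =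
    [seq val (T x) | x <- [seq unshift_cell y | y : S]].
  by rewrite -map_comp; apply: eq_map => y /=; rewrite ffunE.
apply: (permPl (perm_map _ _)); apply: uniq_perm.
- by rewrite map_inj_uniq ?enum_uniq //; apply: can_inj unshift_cellK.
- exact: enum_uniq.
move=> x; rewrite mem_enum inE; apply/mapP; exists (shift_cell x).
  by rewrite mem_enum.
by rewrite shift_cellK.
Qed.

(** Surjectivity of [shift_cell] lets conditions on shifted cells be tested on Young cells. *)
Lemma forall_shift (P : S -> S -> bool) :
  [forall x, forall y, P x y] =
  [forall x, forall y, P (shift_cell x) (shift_cell y)].
Proof.
apply/'forall_forallP/'forall_forallP => H x y; first exact: H.
by rewrite -(unshift_cellK x) -(unshift_cellK y).
Qed.

Lemma shift_fillingE T (x : Y) : shift_filling T (shift_cell x) = T x.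
Proof. by rewrite ffunE shift_cellK. Qed.

Lemma rows_increase_shift T :
  rows_increase (shift_filling T) = rows_increase T.
Proof.
rewrite /rows_increase forall_shift; apply: eq_forallb => x.
apply: eq_forallb => y; rewrite !shift_fillingE; congr (_ ==> _).
rewrite !crow_shift !ccol_shift.
by have [->|] := eqVneq (crow x) (crow y); rewrite //= ltn_add2r.
Qed.

(** Cell [(i, j)] moves to column [i + j - 1], which is constant exactly along antidiagonals. *)
Lemma columns_increase_shift T :
  columns_increase (shift_filling T) = antidiagonals_increase T.
Proof.
rewrite /columns_increase forall_shift; apply: eq_forallb => x.
apply: eq_forallb => y; rewrite !shift_fillingE; congr (_ ==> _).
have /andP[y1 y2] := cell_gt0 y; have /andP[x1 x2] := cell_gt0 x.
rewrite !crow_shift !ccol_shift; congr (_ && _); apply/eqP/eqP; lia.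
Qed.

(** After the shift, column minus row is [j - 1], so diagonals come from Young columns. *)
Lemma diagonals_increase_shift T :
  diagonals_increase (shift_filling T) = columns_increase T.
Proof.
rewrite /diagonals_increase forall_shift; apply: eq_forallb => x.
apply: eq_forallb => y; rewrite !shift_fillingE; congr (_ ==> _).
have /andP[y1 y2] := cell_gt0 y; have /andP[x1 x2] := cell_gt0 x.
rewrite !crow_shift !ccol_shift; congr (_ && _); apply/eqP/eqP; lia.
Qed.

Lemma standard_entries_inj D (T : filling D n) :
  standard_entries T -> injective T.
Proof.
move=> /perm_uniq; rewrite iota_uniq => U x y E.
have /injectiveP : injectiveb (fun x => val (T x)) by [].
by apply; rewrite E.
Qed.

End Shift.

Lemma card_standard_shifted_tableaux :
  #|standard_shifted_tableaux la| =
  #|[set T in standard_tableaux la |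
      [forall x, (1 < ccol x) ==> odd (c_stat T x)]]|.
Proof.
rewrite -(on_card_preimset (onW_bij _ (shift_filling_bij (sumn la)))).
apply: eq_card => T; rewrite !inE standard_entries_shift rows_increase_shift.
rewrite columns_increase_shift diagonals_increase_shift.
apply/and4P/andP => [[HE HR HA HC]|[/and3P[HE HR HC] /forallP H]].
  split; first by apply/and3P.
  by apply/forallP => x; apply/implyP => Hx; rewrite c_stat_eq1.
split => //; apply: c_odd_antidiagonals_increase => //.
  by move=> x; apply/implyP.
exact: standard_entries_inj.
Qed.

End Shape.

(** * Evaluation at [q = -1] *)

Local Open Scope ring_scope.

Lemma horner_qintN1 a : (qint a).[-1] = (odd a)%:Z.
Proof.
rewrite /qint horner_sum; elim: a => [|a IHa]; first by rewrite big_ord0.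
by rewrite big_ord_recr /= IHa hornerXn -signr_odd; case: (odd a).
Qed.

(** Every factor is 0 or 1, and a single even statistic makes the product vanish. *)
Lemma horner_c_qN1 D n (T : filling D n) :
  (c_q T).[-1] = [forall x, (1 < ccol x)%N ==> odd (c_stat T x)]%:Z.
Proof.
rewrite /c_q horner_prod; under eq_bigr do rewrite horner_qintN1.
case: forallP => [H|/forallP].
  by rewrite big1 // => x Hx; have := H x; rewrite Hx /= => ->.
rewrite negb_forall => /existsP[x]; rewrite negb_imply => /andP[Hx /negbTE Ho].
by rewrite (bigD1 x) //= Ho mul0r.
Qed.

Theorem theorem3p18 (n : nat) (la : seq nat)
    (hla : is_partition_of n la) (hdist : distinct_below_largest la) :
  (b_poly la).[-1] = (#|standard_shifted_tableaux la|)%:Z.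
Proof.
have [la_sorted _ _] := hla.
rewrite card_standard_shifted_tableaux // /b_poly horner_sum.
under eq_bigr do rewrite horner_c_qN1.
(* Both sides become sums of 0/1 indicators over all fillings, equal term by term. *)
rewrite -sum1_card -natz natr_sum big_mkcond [RHS]big_mkcond /=; apply: eq_bigr => T _.
by rewrite [in RHS]inE; case: (T \in _); case: [forall x, _].
Qed.
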